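(* Let $F:\mathbb{R}^n\to\mathbb{R}^m$, let $D\subset\mathbb{R}^m$ be closed, let $\Omega=\{x\in\mathbb{R}^n\mid F(x)\in D\}$, let $\bar x\in\Omega$, let $F$ and $f:\mathbb{R}^n\to\mathbb{R}$ be continuously differentiable at $\bar x$, and assume that GGCQ holds at $\bar x$. Let $\mathcal Q$ be a collection of pairs $(Q_1,Q_2)$ of closed convex cones in $\mathbb{R}^m$ fulfilling $$Q_i\subset T_D(F(\bar x)),\qquad (\nabla F(\bar x)^{-1}Q_i)^\circ=\nabla F(\bar x)^TQ_i^\circ,\qquad i=1,2.$$ Assume that $\bar x$ is B-stationary for the program $\min f(x)$ subject to $x\in\Omega$. Then $\bar x$ is $\mathcal Q_M$-stationary if any of the following three conditions holds: 1. There exists a pair $(Q_1,Q_2)\in\mathcal Q$ such that $Q_1^\circ\cap(\ker\nabla F(\bar x)^T+ Q_2^\circ)\subset N_D(F(\bar x))$. 2. $\bar x$ is M-stationary and for every $\lambda\in N_D(F(\bar x))$ there is some pair $(Q_1,Q_2)\in\mathcal Q$ with $\lambda\in Q_1^\circ$. 3. $T_D(F(\bar x))$ is the union of finitely many convex polyhedral sets and for every $t\in T_D(F(\bar x))$ there is some pair $(Q_1,Q_2)\in\mathcal Q$ satisfying $t\in Q_1$.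
   Context: $K^\circ$ is the polar of $K$: $K^\circ=\{z^*\mid \langle z^*,u\rangle\le 0\ \forall u\in K\}$. For $\Gamma\subset\mathbb{R}^d$, $\bar z\in\Gamma$: tangent cone $T_\Gamma(\bar z)=\{u\mid \exists t_k\searrow 0,\ u_k\to u:\ \bar z+t_ku_k\in\Gamma\ \forall k\}$; regular normal cone $\widehat N_\Gamma(\bar z)=(T_\Gamma(\bar z))^\circ$; limiting normal cone $N_\Gamma(\bar z)=\{z^*\mid\exists z_k\to\bar z,\ z_k\in\Gamma,\ z_k^*\to z^*,\ z_k^*\in\widehat N_\Gamma(z_k)\ \forall k\}$. $\nabla F(\bar x)^{-1}Q:=\{u\in\mathbb{R}^n\mid\nabla F(\bar x)u\in Q\}$. GGCQ at $\bar x$: $(T_\Omega(\bar x))^\circ=(T^{\rm lin}_\Omega(\bar x))^\circ$ where $T^{\rm lin}_\Omega(\bar x)=\{u\mid\nabla F(\bar x)u\in T_D(F(\bar x))\}$. Stationarity of $\bar x$: B-stationary means $0\in\nabla f(\bar x)+\widehat N_\Omega(\bar x)$; M-stationary means $0\in\nabla f(\bar x)+\nabla F(\bar x)^TN_D(F(\bar x))$; $\mathcal Q_M$-stationary means that there is a pair $(Q_1,Q_2)\in\mathcal Q$ with $$0\in\nabla f(\bar x)+\nabla F(\bar x)^T\left(Q_1^\circ\cap(\ker\nabla F(\bar x)^T+ Q_2^\circ)\cap N_D(F(\bar x))\right).$$ *)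

(* Defs.v *)
From mathcomp Require Import all_boot all_order all_algebra.
From mathcomp Require Import all_classical all_reals all_analysis.

Set Implicit Arguments.
Unset Strict Implicit.
Unset Printing Implicit Defensive.

Import Order.TTheory GRing.Theory Num.Theory.
Import numFieldNormedType.Exports.

Local Open Scope classical_set_scope.
Local Open Scope ring_scope.

(* Vectors are row vectors, as in the library's Jacobian ['J F x], so the
   Jacobian acts by right multiplication: the usual [J u] and [J^T l] (J being
   the m x n matrix of partial derivatives) are here [u *m 'J F x] and
   [l *m ('J F x)^T]. *)

Section Cones.
Context {R : realType} {d : nat}.
Implicit Types (K Gam P : set 'rV[R]_d) (u v z : 'rV[R]_d).

Definition dot u v : R := (u *m v^T) 0 0.

Definition polar K : set 'rV[R]_d :=
  [set z | forall u, K u -> dot z u <= 0].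

Definition tangent_cone Gam z : set 'rV[R]_d :=
  [set u | exists (t : nat -> R) (v : nat -> 'rV[R]_d),
     [/\ forall k, 0 < t k,
         t @ \oo --> (0 : R),
         v @ \oo --> u
       & forall k, Gam (z + t k *: v k)]].

Definition regular_normal_cone Gam z : set 'rV[R]_d :=
  polar (tangent_cone Gam z).

Definition limiting_normal_cone Gam z : set 'rV[R]_d :=
  [set l | exists (y : nat -> 'rV[R]_d) (w : nat -> 'rV[R]_d),
     [/\ y @ \oo --> z,
         forall k, Gam (y k),
         w @ \oo --> l
       & forall k, regular_normal_cone Gam (y k) (w k)]].

(* The origin is required, which rules out the empty set as a cone. *)
Definition is_cone K : Prop :=
  K 0 /\ forall (t : R) z, 0 < t -> K z -> K (t *: z).

Definition closed_convex_cone K : Prop :=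
  [/\ closed K, convex_set (K : set (convex_lmodType 'rV[R]_d)) & is_cone K].

Definition convex_polyhedral P : Prop :=
  exists (k : nat) (a : 'I_k -> 'rV[R]_d) (b : 'I_k -> R),
    P = [set z | forall i, dot (a i) z <= b i].

Definition finite_union_of_convex_polyhedral P : Prop :=
  exists (k : nat) (C : 'I_k -> set 'rV[R]_d),
    (forall i, convex_polyhedral (C i)) /\ P = \bigcup_i C i.

End Cones.

Section Program.
Context {R : realType} {n m : nat}.
Implicit Types (f : 'rV[R]_n -> R) (F : 'rV[R]_n -> 'rV[R]_m).
Implicit Types (D Q : set 'rV[R]_m) (x : 'rV[R]_n).

Definition gradient f x : 'rV[R]_n :=
  \row_i 'd (f : 'rV[R]_n -> R^o) x (delta_mx 0 i).

Definition continuously_differentiable_at F x : Prop :=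
  (\forall y \near x, differentiable F y) /\
  {for x, continuous (jacobian F)}.

Definition continuously_differentiable_fun_at f x : Prop :=
  (\forall y \near x, differentiable (f : 'rV[R]_n -> R^o) y) /\
  {for x, continuous (gradient f)}.

Definition jac_preimage F x Q : set 'rV[R]_n := [set u | Q (u *m 'J F x)].

Definition jacT_image F x Q : set 'rV[R]_n := [set l *m ('J F x)^T | l in Q].

Definition jacT_kernel F x : set 'rV[R]_m := [set l | l *m ('J F x)^T = 0].

Definition feasible_set F D : set 'rV[R]_n := [set x | D (F x)].

Definition linearized_tangent_cone F D x : set 'rV[R]_n :=
  jac_preimage F x (tangent_cone D (F x)).

Definition GGCQ F D x : Prop :=
  polar (tangent_cone (feasible_set F D) x)
  = polar (linearized_tangent_cone F D x).

Definition B_stationary f F D x : Prop :=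
  [set gradient f x + v | v in regular_normal_cone (feasible_set F D) x] 0.

Definition M_stationary f F D x : Prop :=
  [set gradient f x + v
    | v in jacT_image F x (limiting_normal_cone D (F x))] 0.

(* [Q1^o `&` (ker J^T + Q2^o)] *)
Definition pair_multipliers F x (Q1 Q2 : set 'rV[R]_m) : set 'rV[R]_m :=
  polar Q1 `&` [set k + l | k in jacT_kernel F x & l in polar Q2].

Definition QM_stationary f F D x (QQ : set (set 'rV[R]_m * set 'rV[R]_m)) :
    Prop :=
  exists Q1 Q2, QQ (Q1, Q2) /\
    [set gradient f x + v
      | v in jacT_image F x
               (pair_multipliers F x Q1 Q2 `&` limiting_normal_cone D (F x))] 0.

Definition admissible_cone F D x Q : Prop :=
  [/\ closed_convex_cone Q,
      Q `<=` tangent_cone D (F x)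
    & polar (jac_preimage F x Q) = jacT_image F x (polar Q)].

End Program.

(* Main.v *)
Require Import Defs.
From mathcomp Require Import all_boot all_order all_algebra.
From mathcomp Require Import all_classical all_reals all_analysis.
From mathcomp Require Import ring lra.
Import Order.TTheory GRing.Theory Num.Theory.
Import numFieldNormedType.Exports.
Local Open Scope classical_set_scope.
Local Open Scope ring_scope.

(** Write [J] for the Jacobian of [F] at [xbar], [T] for the tangent cone of [D]
    at [F xbar], and [g] for minus the gradient of [f].  B-stationarity and GGCQ
    together say that [g] is polar to [{u | u *m J \in T}].  As [Q1] and [Q2] lie
    in [T], [g] is polar to both preimages [{u | u *m J \in Qi}], and
    admissibility turns this into multipliers [li] in the polar of [Qi] with
    [li *m J^T = g].  Any two solutions of [l *m J^T = g] differ by an element of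
    the kernel of [J^T], so every [l] in the polar of [Q1] with [l *m J^T = g] is
    a pair multiplier; what has to be found is such an [l] which is also a
    limiting normal.  Under the first condition the multiplier [l1] will do, and
    under the second the one given by M-stationarity.

    Under the third condition the multiplier is constructed.  If [g = 0], take
    [l = 0].  Otherwise minimise the Euclidean length of [u *m J - t] over [t] in
    [T] and [u] with [<g, u> = 1].
    The set of these differences is closed because [T] is a finite union of
    polyhedra and a projection of a polyhedron is closed, by Fourier-Motzkin
    elimination ([closed_solvable_rhs]); so there is a minimiser [(u0, t0)].
    The minimum [y0 = u0 *m J - t0] is nonzero, as otherwise [u0 *m J] would lie
    in [T] although [<g, u0> > 0].  Optimality in [u] gives
    [y0 *m J^T = |y0|^2 *: g] ([polyhedral_multiplier]), so that a multiple [l]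
    of [y0] solves [l *m J^T = g].  Optimality in [t] says that [t0] is a point
    of [T] nearest to [u0 *m J], and this has two consequences:
    - [l] is a regular normal of [T] at [t0].  If [t0] lies in the convex cone
      [Q1], all of [Q1] is tangent to [T] at [t0], so [l] is in the polar of [Q1].
    - [l] is a limiting normal of [D] at [F xbar]
      ([limiting_normal_tangent_cone]): the blow-ups [(D - F xbar) / t_k]
      approach [T], and projecting a point of the segment from [t0] to [u0 *m J]
      onto them gives normals of [D] that converge to the required direction. *)

Set Implicit Arguments.
Unset Strict Implicit.

(** * The scalar product *)

Section Dot.
Context {R : realType} {d : nat}.
Implicit Types u v w p : 'rV[R]_d.

Lemma dotE u v : dot u v = \sum_i u 0 i * v 0 i.
Proof. by rewrite /dot mxE; apply: eq_bigr => i _; rewrite mxE. Qed.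

Lemma dotC u v : dot u v = dot v u.
Proof. by rewrite !dotE; apply: eq_bigr => i _; rewrite mulrC. Qed.

Lemma dotDl u v w : dot (u + v) w = dot u w + dot v w.
Proof. by rewrite /dot mulmxDl mxE. Qed.

Lemma dotZl (a : R) u v : dot (a *: u) v = a * dot u v.
Proof. by rewrite /dot -scalemxAl mxE. Qed.

Lemma dotNl u v : dot (- u) v = - dot u v.
Proof. by rewrite /dot mulNmx mxE. Qed.

Lemma dotBl u v w : dot (u - v) w = dot u w - dot v w.
Proof. by rewrite dotDl dotNl. Qed.

Lemma dotDr u v w : dot w (u + v) = dot w u + dot w v.
Proof. by rewrite !(dotC w) dotDl. Qed.

Lemma dotZr (a : R) u v : dot u (a *: v) = a * dot u v.
Proof. by rewrite !(dotC u) dotZl. Qed.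

Lemma dotNr u v : dot u (- v) = - dot u v.
Proof. by rewrite !(dotC u) dotNl. Qed.

Lemma dotBr u v w : dot w (u - v) = dot w u - dot w v.
Proof. by rewrite !(dotC w) dotBl. Qed.

Lemma dot0l u : dot 0 u = 0.
Proof. by rewrite /dot mul0mx mxE. Qed.

Lemma dot0r u : dot u 0 = 0.
Proof. by rewrite dotC dot0l. Qed.

Lemma dot_ge0 u : 0 <= dot u u.
Proof. by rewrite dotE sumr_ge0// => i _; rewrite -expr2 sqr_ge0. Qed.

(** The topology of row vectors is that of the maximum norm; this inequality and
    the continuity of [dot] are all that links it to the Euclidean structure. *)
Lemma sqr_norm_le_dot u : `|u| ^+ 2 <= dot u u.
Proof.
have [->|u0] := eqVneq u 0; first by rewrite normr0 expr0n dot_ge0.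
have /mx_norm_neq0[[i j] /= uij] : mx_norm u != 0 by rewrite (normr_eq0 u).
have -> : `|u| = `|u i j| := uij.
rewrite (ord1 i) real_normK ?num_real// dotE (bigD1 j)//= expr2 lerDl.
by rewrite sumr_ge0// => k _; rewrite -expr2 sqr_ge0.
Qed.

Lemma dot_eq0 u : dot u u <= 0 -> u = 0.
Proof.
move=> u0; apply/eqP; rewrite -normr_eq0 -sqrf_eq0 eq_le sqr_ge0 andbT.
exact: le_trans (sqr_norm_le_dot u) u0.
Qed.

Lemma cvg_dot (T : Type) (F : set_system T) {FF : Filter F}
    (f g : T -> 'rV[R]_d) u v :
  f @ F --> u -> g @ F --> v -> dot (f x) (g x) @[x --> F] --> dot u v.
Proof.
move=> fu gv; under eq_cvg do rewrite dotE.
rewrite dotE; elim: (index_enum _) => [|i s ih].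
  rewrite big_nil.
  have -> : (fun x => \sum_(i <- [::]) f x 0 i * g x 0 i) = cst 0.
    by apply/funext => x; rewrite big_nil.
  exact: cvg_cst.
rewrite big_cons.
have -> : (fun x => \sum_(j <- i :: s) f x 0 j * g x 0 j) =
    (fun x => f x 0 i * g x 0 i) \+ (fun x => \sum_(j <- s) f x 0 j * g x 0 j).
  by apply/funext => x; rewrite big_cons.
have coord w : {for w, continuous (fun y : 'rV[R]_d => y 0 i)}.
  exact: coord_continuous.
apply: cvgD ih; apply: cvgM.
  exact: cvg_comp fu (coord u).
exact: cvg_comp gv (coord v).
Qed.

Lemma dotr_continuous u : continuous (dot u).
Proof.
move=> v.
exact (@cvg_dot _ (nbhs v) _ (cst u) id u v (cvg_cst u) cvg_id).
Qed.

Lemma sqdist_continuous p : continuous (fun x : 'rV[R]_d => dot (p - x) (p - x)).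
Proof.
move=> v; have dv : (fun w => p - w) @ v --> p - v.
  by apply: (@cvgB _ _ _ (nbhs v) _ (cst p) id p v); [exact: cvg_cst | exact: cvg_id].
exact (@cvg_dot _ (nbhs v) _ (fun w => p - w) (fun w => p - w) _ _ dv dv).
Qed.

End Dot.

(** * Projections *)
Section Projection.
Context {R : realType} {d : nat}.
Implicit Types (S : set 'rV[R]_d) (p y : 'rV[R]_d).

(** The Euclidean projection, as a relation because the minimiser is not unique
    on a nonconvex set. *)
Definition nearest S p y : Prop :=
  S y /\ forall x, S x -> dot (p - y) (p - y) <= dot (p - x) (p - x).

Lemma norm_le_of_sqdist p y (M : R) :
  0 <= M -> dot (p - y) (p - y) <= M ^+ 2 -> `|y| <= `|p| + M.
Proof.
move=> M0 h; have : `|p - y| <= M.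
  by rewrite -ler_sqr ?nnegrE//; apply: le_trans (sqr_norm_le_dot _) h.
by have := ler_normB p (p - y); rewrite subKr; lra.
Qed.

Lemma sublevel_compact S p (M : R) : closed S ->
  compact (S `&` [set x : 'rV[R]_d | dot (p - x) (p - x) <= M]).
Proof.
move=> cS; apply: bounded_closed_compact; last first.
  apply: closedI => //.
  apply: (@preimage_closed _ _ (fun x : 'rV[R]_d => dot (p - x) (p - x))
    [set r | r <= M]) (@closed_le _ _) => x _.
  exact: sqdist_continuous.
exists (`|p| + (1 + `|M|)); split; first exact: num_real.
move=> r pr x [_ /= xM]; apply/ltW; apply: le_lt_trans pr.
apply: norm_le_of_sqdist; first by rewrite addr_ge0.
by have := normr_ge0 M; have := ler_norm M; nra.
Qed.

Lemma nearest_exists S p : closed S -> S !=set0 -> exists y, nearest S p y.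
Proof.
move=> cS [x0 Sx0]; set M := dot (p - x0) (p - x0).
have [||y] := @EVT_min_rV R d (fun x : 'rV[R]_d => dot (p - x) (p - x)) _ _
    (@sublevel_compact S p M cS).
- by exists x0; split => //=.
- by apply: continuous_subspaceT; exact: sqdist_continuous.
rewrite inE => -[Sy yM] ymin; exists y; split => // x Sx.
have [xM|/ltW xM] := leP (dot (p - x) (p - x)) M; last exact: le_trans xM.
by apply: ymin; rewrite inE.
Qed.

End Projection.

(** * Tangent and normal cones *)

Lemma cvg_of_inv_dist {R : realType} {d : nat} (v : nat -> 'rV[R]_d) u :
  (forall k, `|u - v k| < k.+1%:R^-1) -> v @ \oo --> u.
Proof.
move=> uv; apply/cvgrPdist_lt => e e0.
have /cvgrPdist_lt/(_ _ e0) := @cvg_harmonic R.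
apply: filterS => k; rewrite sub0r normrN ger0_norm ?harmonic_ge0//.
exact: lt_trans (uv k).
Qed.

Section Cones.
Context {R : realType} {d : nat}.
Implicit Types (Gam K : set 'rV[R]_d) (z u v l p y : 'rV[R]_d).

Lemma tangent_coneP Gam z u : tangent_cone Gam z u <->
  forall e : R, 0 < e -> exists (t : R) v,
    [/\ 0 < t, t < e, `|u - v| < e & Gam (z + t *: v)].
Proof.
split=> [[t [v [t0 tcvg vcvg Gtv]]] e e0|approx].
  have te : \forall k \near \oo, t k < e by exact: cvgr_lt tcvg _ e0.
  have ve : \forall k \near \oo, `|u - v k| < e.
    by move/cvgrPdist_lt: vcvg; exact.
  have [k [tk vk]] := filter_ex (filterI te ve).
  by exists (t k), (v k).
have inv_gt0 k : 0 < k.+1%:R^-1 :> R by rewrite invr_gt0.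
have /choice[tv tvP] (k : nat) : exists tv : R * 'rV[R]_d,
    [/\ 0 < tv.1, tv.1 < k.+1%:R^-1, `|u - tv.2| < k.+1%:R^-1
      & Gam (z + tv.1 *: tv.2)].
  by have [t [v tvP]] := approx _ (inv_gt0 k); exists (t, v).
exists (fun k => (tv k).1), (fun k => (tv k).2); split => [k|||k].
- by case: (tvP k).
- apply: (@squeeze_cvgr _ _ _ _ (fun=> 0) (@harmonic R)).
  + by apply: nearW => k; case: (tvP k) => /ltW-> /ltW->.
  + exact: cvg_cst.
  + exact: cvg_harmonic.
- by apply: cvg_of_inv_dist => k; case: (tvP k).
- by case: (tvP k).
Qed.

(** It suffices to approximate [(z, l)] by one pair at a time: the sequences asked
    for by the definition are picked along [1 / k]. *)
Lemma limiting_normal_cone_approx Gam z l :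
  (forall e : R, 0 < e -> exists y w,
    [/\ Gam y, `|z - y| < e, `|l - w| < e & regular_normal_cone Gam y w]) ->
  limiting_normal_cone Gam z l.
Proof.
move=> approx.
have /choice[yw ywP] (k : nat) : exists yw : 'rV[R]_d * 'rV[R]_d,
    [/\ Gam yw.1, `|z - yw.1| < k.+1%:R^-1, `|l - yw.2| < k.+1%:R^-1
      & regular_normal_cone Gam yw.1 yw.2].
  have [|y [w ywP]] := approx k.+1%:R^-1; first by rewrite invr_gt0.
  by exists (y, w).
exists (fun k => (yw k).1), (fun k => (yw k).2); split => [|k||k].
- by apply: cvg_of_inv_dist => k; case: (ywP k).
- by case: (ywP k).
- by apply: cvg_of_inv_dist => k; case: (ywP k).
- by case: (ywP k).
Qed.

Lemma tangent_cone0 Gam z : Gam z -> tangent_cone Gam z 0.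
Proof.
move=> Gz; apply/tangent_coneP => e e0; exists (e / 2), 0.
by rewrite subrr normr0 scaler0 addr0; split => //; lra.
Qed.

Lemma tangent_coneZ Gam z (a : R) u :
  0 < a -> tangent_cone Gam z u -> tangent_cone Gam z (a *: u).
Proof.
move=> a0 [t [v [t0 tcvg vcvg Gtv]]].
exists (fun k => a^-1 * t k), (fun k => a *: v k); split => [k|||k].
- by rewrite mulr_gt0// invr_gt0.
- by rewrite -(mulr0 a^-1); apply: cvgM => //; exact: cvg_cst.
- exact: cvgZr.
- by rewrite scalerA mulrAC mulVf ?gt_eqF// mul1r.
Qed.

Lemma polarZ K (a : R) l : 0 < a -> polar K l -> polar K (a *: l).
Proof. by move=> a0 Kl u Ku; rewrite dotZl pmulr_rle0// Kl. Qed.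

Lemma limiting_normal_coneZ Gam z (a : R) l : 0 < a ->
  limiting_normal_cone Gam z l -> limiting_normal_cone Gam z (a *: l).
Proof.
move=> a0 [y [w [ycvg Gy wcvg wN]]]; exists y, (fun k => a *: w k).
split=> // [|k]; first exact: cvgZr.
exact: polarZ (wN k).
Qed.

(** Proximal normals are regular normals: moving from [y] to [y + t *: v] inside
    [Gam] cannot decrease the distance to [p], that is
    [2 <p - y, v> <= t |v|^2], and then [t] tends to [0]. *)
Lemma nearest_regular_normal Gam p y :
  nearest Gam p y -> regular_normal_cone Gam y (p - y).
Proof.
move=> [Gy ymin] u [t [v [t0 tcvg vcvg Gtv]]].
have bound k : 2 * dot (p - y) (v k) <= t k * dot (v k) (v k).
  have := ymin _ (Gtv k); rewrite opprD addrA.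
  rewrite (dotBl (p - y)) !(dotBr _ (t k *: v k)).
  rewrite (dotC (t k *: v k) (p - y)) !dotZr dotZl => h.
  by rewrite -(ler_pM2l (t0 k)); lra.
have : 2 * dot (p - y) u <= 0 * dot u u.
  apply: (@ler_cvg_to _ \oo _ R (fun k => 2 * dot (p - y) (v k))
    (fun k => t k * dot (v k) (v k))).
  - by apply: cvgM; [exact: cvg_cst|apply: cvg_dot => //; exact: cvg_cst].
  - by apply: cvgM => //; exact: cvg_dot.
  - exact: nearW.
by rewrite mul0r pmulr_rle0.
Qed.

(** A convex cone is closed under addition, so that the whole half-line
    [z + t *: u] stays in [Q]. *)
Lemma tangent_cone_convex_sub (Q : set 'rV[R]_d) Gam z u :
  closed_convex_cone Q -> Q `<=` Gam -> Q z -> Q u -> tangent_cone Gam z u.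
Proof.
move=> [_ Qconv [_ Qcone]] QG Qz Qu; apply/tangent_coneP => e e0.
exists (e / 2), u; rewrite subrr normr0; split; [lra|lra|by []|apply: QG].
have e2 : 0 < e / 2 by lra.
have half0 : 0 <= (2^-1 : R) by lra.
have half1 : (2^-1 : R) <= 1 by lra.
have := Qconv z ((e / 2) *: u) (Itv01 half0 half1).
rewrite !inE => /(_ Qz (Qcone _ _ e2 Qu)) Qmid.
have -> : z + (e / 2) *: u =
    2 *: (2^-1 *: z + (1 - 2^-1) *: ((e / 2) *: u)).
  have -> : 1 - 2^-1 = 2^-1 :> R by lra.
  by rewrite -scalerDr scalerA divff ?scale1r.
by apply: Qcone Qmid; lra.
Qed.

Lemma cluster_seq (T : topologicalType) (w : nat -> T) (x : T) (P : nat -> Prop)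
    (B : set T) :
  cluster (w @ \oo) x -> (\forall k \near \oo, P k) -> nbhs x B ->
  exists k, P k /\ B (w k).
Proof.
move=> clx Pk xB.
have [|_ [[k Pwk <-] Bk]] := clx (w @` [set k | P k]) B _ xB; last by exists k.
by apply: filterS Pk => k Pwk; exists k.
Qed.

(** Normals of the tangent cone are limiting normals of the set.  Halving the
    normal [p - y] makes [y] the only nearest point to the midpoint [q] of [p] and
    [y].  Project [q] onto the blow-ups [(Gam - z) / t_k], where [t_k] is a sequence
    that witnesses [y] as a tangent.  Every cluster point of the projections [w_k]
    is tangent and no further from [q] than [y], so it is [y]; rescaled, [q - w_k]
    is a proximal normal of [Gam] at [z + t_k *: w_k], and it approaches
    [(p - y) / 2]. *)
Lemma limiting_normal_tangent_cone Gam z p y : closed Gam ->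
  nearest (tangent_cone Gam z) p y -> limiting_normal_cone Gam z (p - y).
Proof.
move=> Gcl [Ty ymin].
pose q := y + 2^-1 *: (p - y).
(* [|q - x|^2 >= |q - y|^2 + |x - y|^2 / 2] for tangent [x], by the minimality
   of [y] for [p]. *)
have q_unique x : tangent_cone Gam z x ->
    dot (q - x) (q - x) <= dot (q - y) (q - y) -> x = y.
  move=> Tx; have := ymin _ Tx; rewrite /q.
  rewrite [y + _ - x]addrAC [y + _ - y]addrAC subrr add0r.
  have -> : p - x = (p - y) + (y - x) by rewrite addrA subrK.
  move=> le_y le_x; apply/esym/eqP; rewrite -subr_eq0; apply/eqP/dot_eq0.
  move: (p - y) (y - x) le_y le_x => n m.
  by rewrite !dotDl !dotDr !dotZl !dotZr (dotC n m); lra.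
have [t [v [t0 tcvg vcvg Gtv]]] := Ty.
pose Gk k := [set x : 'rV[R]_d | Gam (z + t k *: x)].
have Gkcl k : closed (Gk k).
  apply: (@preimage_closed _ _ (fun x : 'rV[R]_d => z + t k *: x) Gam) => //.
  move=> x _; apply: (@cvgD _ _ _ (nbhs x) _ (cst z) (fun x => t k *: x) z).
    exact: cvg_cst.
  exact: scaler_continuous.
have /choice[w wP] (k : nat) : exists w, nearest (Gk k) q w.
  by apply: nearest_exists => //; exists (v k); exact: Gtv.
have w_le k : dot (q - w k) (q - w k) <= dot (q - v k) (q - v k).
  by case: (wP k) => _; apply; exact: Gtv.
have qv_cvg : dot (q - v k) (q - v k) @[k --> \oo] --> dot (q - y) (q - y).
  exact: (cvg_comp v _ vcvg (@sqdist_continuous _ _ q y)).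
have q_lim (e : R) : 0 < e ->
    \forall k \near \oo, dot (q - w k) (q - w k) < dot (q - y) (q - y) + e.
  move=> e0; near=> k; apply: le_lt_trans (w_le k) _; near: k.
  by apply: (cvgr_lt _ qv_cvg); rewrite ltrDl.
have t_lim (e : R) : 0 < e -> \forall k \near \oo, t k < e.
  by move=> e0; apply: (cvgr_lt _ tcvg).
have [x [_ clx]] : setT `&`
    [set x : 'rV[R]_d | dot (q - x) (q - x) <= dot (q - y) (q - y) + 1] `&`
    cluster (w @ \oo) !=set0.
  apply: (sublevel_compact closedT).
  by apply: filterS (q_lim 1 ltr01) => k /ltW.
have xy : x = y.
  apply: q_unique.
    apply/tangent_coneP => e e0.
    have [k [tk wk]] := cluster_seq clx (t_lim e e0) (nbhsx_ballx x e e0).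
    exists (t k), (w k); split => //; last by case: (wP k).
    by move: wk; rewrite -ball_normE.
  apply/ler_addgt0Pr => e e0; rewrite leNgt; apply/negP => lt_x.
  have [k [lt_k]] := cluster_seq clx (q_lim e e0)
    (cvgr_gt _ (@sqdist_continuous _ _ q x) _ lt_x).
  by rewrite ltNge ltW.
apply: limiting_normal_cone_approx => e e0.
(* [|w k| <= |y| + e / 2], so this bound on [t k] keeps [t k *: w k] below [e]. *)
have M0 : 0 < 1 + `|y| + e by rewrite -addrA ltr_wpDr// addr_ge0// ltW.
have e'0 : 0 < e / (1 + `|y| + e) by rewrite divr_gt0.
have e20 : 0 < e / 2 by rewrite divr_gt0.
have [k [tk]] := cluster_seq clx (t_lim _ e'0) (nbhsx_ballx x _ e20).
rewrite xy -ball_normE /= => wk.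
exists (z + t k *: w k), (2 *: (q - w k)); split.
- by case: (wP k).
- rewrite opprD addNKr normrN normrZ gtr0_norm//.
  have : `|w k| <= `|y| + e / 2.
    by have := ler_normB y (y - w k); rewrite subKr; lra.
  move: tk; rewrite ltr_pdivlMr//; have := t0 k; have := normr_ge0 (w k); nra.
- have -> : p - y - 2 *: (q - w k) = - 2 *: (y - w k).
    by apply/rowP => i; rewrite /q !mxE; field.
  by rewrite normrZ normrN ger0_norm//; lra.
- have -> : 2 *: (q - w k) = (2 / t k) *: ((z + t k *: q) - (z + t k *: w k)).
    rewrite opprD addrACA subrr add0r -scalerBr scalerA divfK// gt_eqF//.
  apply: polarZ; first by rewrite divr_gt0.
  apply: nearest_regular_normal; split; first by case: (wP k).
  move=> d' Dd'; have [_ /(_ ((t k)^-1 *: (d' - z)))] := wP k.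
  rewrite /Gk /= scalerA divff ?gt_eqF// scale1r addrC subrK => /(_ Dd').
  have -> : z + t k *: q - d' = t k *: (q - (t k)^-1 *: (d' - z)).
    rewrite scalerBr scalerA divff ?gt_eqF// scale1r opprB addrA.
    by rewrite [z + _]addrC.
  rewrite opprD addrACA subrr add0r -scalerBr !dotZl !dotZr !mulrA.
  by rewrite ler_pM2l// mulr_gt0.
Unshelve. all: by end_near. Qed.

End Cones.

(** * Linear images of polyhedra are closed *)

Section FourierMotzkin.
Context {R : realType}.

(** The elimination step combines an upper bound on the eliminated variable
    (coefficient [x > 0]) with a lower one ([y < 0]), the weights being such that
    the variable cancels.  To index the new system by all pairs, an inequality
    without the variable ([x = 0]) is kept for every partner, and the remaining
    pairs give the trivial inequality. *)
Definition fm_weight (x y : R) : R * R :=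
  if x == 0 then (1, 0) else if (0 < x) && (y < 0) then (- y, x) else (0, 0).

Lemma fm_weight_ge0 x y : 0 <= (fm_weight x y).1 /\ 0 <= (fm_weight x y).2.
Proof.
by rewrite /fm_weight; case: ifP => //= _; case: ifP => //= /andP[x0 y0]; lra.
Qed.

Lemma fm_weight_cancel x y : (fm_weight x y).1 * x + (fm_weight x y).2 * y = 0.
Proof.
rewrite /fm_weight; case: ifP => /= [/eqP->|_]; first by lra.
by case: ifP => /= _; lra.
Qed.

(** One variable: the largest lower bound, or the smallest upper bound when there
    is no lower one, is a solution. *)
Lemma linear_ineqs_solvable (I : finType) (c b : I -> R) :
  (exists x, forall i, c i * x <= b i) <->
  (forall i j, 0 <= (fm_weight (c i) (c j)).1 * b i
                  + (fm_weight (c i) (c j)).2 * b j).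
Proof.
split=> [[x cx] i j|compat].
  have [p0 q0] := fm_weight_ge0 (c i) (c j).
  have := fm_weight_cancel (c i) (c j).
  move: (fm_weight _ _) p0 q0 => [p q] /= p0 q0 pq.
  have := ler_wpM2l p0 (cx i); have := ler_wpM2l q0 (cx j).
  have : p * (c i * x) + q * (c j * x) = 0 by rewrite !mulrA -mulrDl pq mul0r.
  lra.
have b0 i : c i = 0 -> 0 <= b i.
  by move=> ci; have := compat i i; rewrite /fm_weight ci eqxx /=; lra.
have bb i j : 0 < c i -> c j < 0 -> 0 <= - c j * b i + c i * b j.
  by move=> ci cj; have := compat i j; rewrite /fm_weight gt_eqF// ci cj.
have [j0 cj0|nneg] := pickP (fun j => c j < 0).
  case: (@arg_maxP _ _ _ j0 (fun j => c j < 0) (fun j => b j / c j) cj0) => j cj jmax.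
  exists (b j / c j) => i; have [ci|ci|ci] := ltgtP (c i) 0.
  - by have /= := jmax i ci; rewrite ler_ndivrMr// mulrC.
  - have := bb i j ci cj; rewrite mulrA ler_ndivrMr//; lra.
  - by rewrite ci mul0r b0.
have [i0 ci0|npos] := pickP (fun i => 0 < c i).
  case: (@arg_minP _ _ _ i0 (fun i => 0 < c i) (fun i => b i / c i) ci0) => i ci imin.
  exists (b i / c i) => j; have [cj|cj|cj] := ltgtP (c j) 0.
  - by rewrite nneg in cj.
  - by have /= := imin j cj; rewrite ler_pdivlMr// mulrC.
  - by rewrite cj mul0r b0.
exists 0 => i; rewrite mulr0; apply: b0; apply/eqP.
by rewrite eq_le !leNgt nneg npos.
Qed.

Lemma dot_recl n (a v : 'rV[R]_n.+1) :
  dot a v = a 0 0 * v 0 0 + dot (col' 0 a) (col' 0 v).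
Proof.
rewrite !dotE big_ord_recl; congr (_ + _).
by apply: eq_bigr => i _; rewrite !mxE.
Qed.

(** Fourier-Motzkin elimination.  The right-hand sides are arbitrary continuous
    functions of a parameter, a class that is stable under the nonnegative
    combinations formed by eliminating a variable; once no variable is left, the
    set is cut out by finitely many inequalities [0 <= b i w]. *)
Lemma closed_solvable_rhs (W : topologicalType) n (I : finType)
    (a : I -> 'rV[R]_n) (b : I -> W -> R) :
  (forall i, continuous (b i)) ->
  closed [set w | exists v, forall i, dot (a i) v <= b i w].
Proof.
elim: n I a b => [|n ih] I a b bcont.
  have -> : [set w | exists v, forall i, dot (a i) v <= b i w] =
      \bigcap_i (b i @^-1` [set r | 0 <= r]).
    apply/seteqP; split=> [w [v vP] i _ /=|w wP].
      by have := vP i; rewrite dotE big_ord0.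
    by exists 0 => i; rewrite dot0r; exact: wP.
  apply: closed_bigI => i _; apply: preimage_closed (@closed_ge _ _).
  by move=> x _; exact: bcont.
pose p ij := (fm_weight (a ij.1 0 0) (a ij.2 0 0)).1.
pose q ij := (fm_weight (a ij.1 0 0) (a ij.2 0 0)).2.
have := ih (I * I)%type (fun ij => p ij *: col' 0 (a ij.1) + q ij *: col' 0 (a ij.2))
  (fun ij w => p ij * b ij.1 w + q ij * b ij.2 w).
set elim := (X in closed X); set goal := (X in _ -> closed X).
suff -> : goal = elim.
  apply=> ij w; apply: cvgD; apply: cvgM; (exact: cvg_cst || exact: bcont).
apply/seteqP; split=> w [v vP].
  exists (col' 0 v) => -[i j] /=.
  have /linear_ineqs_solvable/(_ i j) : exists x, forall i,
      a i 0 0 * x <= b i w - dot (col' 0 (a i)) (col' 0 v).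
    by exists (v 0 0) => k; have := vP k; rewrite dot_recl; lra.
  rewrite dotDl !dotZl !mulrBr /p /q /=; lra.
have /linear_ineqs_solvable[x xP] : forall i j,
    0 <= (fm_weight (a i 0 0) (a j 0 0)).1 * (b i w - dot (col' 0 (a i)) v)
       + (fm_weight (a i 0 0) (a j 0 0)).2 * (b j w - dot (col' 0 (a j)) v).
  by move=> i j; have := vP (i, j); rewrite dotDl !dotZl !mulrBr /p /q /=; lra.
exists (\row_j oapp (fun j' => v 0 j') x (unlift 0 j)) => i.
rewrite dot_recl mxE unlift_none /=.
rewrite (_ : col' 0 (\row_j _) = v); first by have := xP i; lra.
by apply/rowP => j; rewrite !mxE liftK.
Qed.

End FourierMotzkin.

(** * A multiplier by projection onto a polyhedral cone *)

(** First-order condition for a minimum of a quadratic on a line: both uses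
    perturb a shortest vector along a direction in which it may move both ways. *)
Lemma quadratic_small_eq0 {R : realType} (b c : R) :
  (forall s, `|s| < 1 -> 2 * s * b <= s ^+ 2 * c) -> b = 0.
Proof.
move=> small; apply/eqP; apply: contraT => b0.
have M0 : 0 < 1 + `|b| + `|c| by rewrite -addrA ltr_wpDr// addr_ge0.
(* A step in the direction of [b], short enough for the linear term to win. *)
set s := b / (1 + `|b| + `|c|).
have sM : s * (1 + `|b| + `|c|) = b by rewrite divfK// gt_eqF.
have s0 : s != 0 by rewrite mulf_neq0// invr_eq0 gt_eqF.
have s1 : `|s| < 1.
  rewrite normrM normfV (gtr0_norm M0) ltr_pdivrMr// mul1r.
  by have := normr_ge0 c; lra.
have := small s s1; rewrite -[X in _ * X]sM.
have : 0 < s ^+ 2 by rewrite exprn_even_gt0.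
by have := ler_norm c; have := normr_ge0 b; nra.
Qed.

Section Multiplier.
Context {R : realType} {n m : nat}.
Implicit Types (J : 'M[R]_(n, m)) (T : set 'rV[R]_m) (g u : 'rV[R]_n).

Lemma dot_mulmxr J (l : 'rV[R]_m) u : dot l (u *m J) = dot (l *m J^T) u.
Proof. by rewrite /dot trmx_mul mulmxA. Qed.

(** [t] is also the point nearest to [p] on its own ray. *)
Lemma nearest_cone_orthogonal T p t :
  (forall a t, 0 < a -> T t -> T (a *: t)) -> nearest T p t -> dot (p - t) t = 0.
Proof.
move=> TZ [Tt tmin]; apply: (@quadratic_small_eq0 _ _ (dot t t)) => s.
rewrite ltr_norml => /andP[s1 _].
have /tmin : T ((1 + s) *: t) by apply: TZ => //; lra.
have -> : p - (1 + s) *: t = (p - t) - s *: t.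
  by rewrite scalerDl scale1r opprD addrA.
rewrite (dotBl (p - t)) !(dotBr _ (s *: t)) (dotC (s *: t) (p - t)) !dotZr !dotZl.
by lra.
Qed.

(** The values [u *m J - t] over which the multiplier argument minimises; the
    point [t] of [T] is eliminated as [u *m J - y], and the equation on [u] is
    written as two inequalities. *)
Lemma closed_slice J T g : finite_union_of_convex_polyhedral T ->
  closed [set y | exists u, T (u *m J - y) /\ dot g u = 1].
Proof.
move=> [k [C [Cpoly ->]]].
have -> : [set y | exists u, (\bigcup_i C i) (u *m J - y) /\ dot g u = 1] =
    \bigcup_i [set y | exists u, C i (u *m J - y) /\ dot g u = 1].
  apply/seteqP; split=> [y [u [[i _ Ci] gu]]|y [i _ [u [Ci gu]]]].
    by exists i => //; exists u.
  by exists u; split => //; exists i.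
apply: closed_bigcup => [|i _]; first exact: finite_finset.
have [r [a [b ->]]] := Cpoly i.
pose lhs (s : 'I_r + bool) : 'rV[R]_n :=
  match s with inl j => a j *m J^T | inr e => (-1) ^+ e *: g end.
pose rhs (s : 'I_r + bool) (y : 'rV[R]_m) : R :=
  match s with inl j => b j + dot (a j) y | inr e => (-1) ^+ e end.
have := @closed_solvable_rhs R _ n _ lhs rhs.
set S := (X in closed X); set S' := (X in _ -> closed X).
suff -> : S' = S.
  apply; case=> [j|e] y; last exact: (@cst_continuous _ R ((-1) ^+ e)).
  apply: (@cvgD _ R^o _ (nbhs y) _ (cst (b j)) (dot (a j)) (b j)).
    exact: cvg_cst.
  exact: dotr_continuous.
apply/seteqP; split=> y [u].
  move=> [Cu gu]; exists u; case=> [j|e] /=.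
    by have := Cu j; rewrite dotBr dot_mulmxr; lra.
  by rewrite dotZl gu mulr1.
move=> uP; exists u; split=> [j|].
  by have := uP (inl j); rewrite /= dotBr dot_mulmxr; lra.
have := uP (inr false); have := uP (inr true).
by rewrite /= !dotZl expr0 expr1; lra.
Qed.

(** A version of Farkas' lemma for a nonconvex polyhedral cone.  With a convex [T]
    the multiplier can be chosen polar to [T]; here it is only normal to [T] at
    some point [t], which is why it is returned as a multiple of [p - t] with [t]
    nearest to [p]: both regular normality at [t] and limiting normality at the
    apex can be read off from that. *)
Lemma polyhedral_multiplier J T g :
  finite_union_of_convex_polyhedral T -> T 0 ->
  (forall a t, 0 < a -> T t -> T (a *: t)) ->
  polar [set u | T (u *m J)] g ->
  exists p t c, [/\ 0 < c, nearest T p t & (c *: (p - t)) *m J^T = g].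
Proof.
move=> Tpoly T0 TZ gpolar.
have [->|g0] := eqVneq g 0.
  exists 0, 0, 1; rewrite subrr scaler0 mul0mx; split => //; split => // x _.
  by rewrite subrr dot0l dot_ge0.
have gg0 : 0 < dot g g.
  by rewrite lt_neqAle dot_ge0 andbT eq_sym; apply: contra g0 => /eqP h;
     rewrite (@dot_eq0 _ _ g) ?h.
(* The nearest point to the origin of the slice; the slice contains
   [u *m J] for [u = g / |g|^2], since [T] contains [0]. *)
pose S := [set y | exists u, T (u *m J - y) /\ dot g u = 1].
have [|y0 [[u0 [Tt0 gu0]] ymin]] := @nearest_exists R m S 0 (@closed_slice J T g Tpoly).
  exists ((dot g g)^-1 *: g *m J), ((dot g g)^-1 *: g).
  by rewrite subrr dotZr mulVf ?gt_eqF.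
have {}ymin y : S y -> dot y0 y0 <= dot y y.
  by move=> /ymin; rewrite !sub0r !dotNl !dotNr !opprK.
pose t0 := u0 *m J - y0.
have y0E : y0 = u0 *m J - t0 by rewrite /t0 subKr.
have t0near : nearest T (u0 *m J) t0.
  split=> // t Tt; rewrite -y0E; apply: ymin; exists u0.
  by rewrite subKr.
have r0 : 0 < dot y0 y0.
  rewrite lt_neqAle dot_ge0 andbT eq_sym; apply/eqP => y00.
  have /dot_eq0 y0_eq0 : dot y0 y0 <= 0 by rewrite y00.
  by have := gpolar u0; rewrite /= gu0 -(subr0 (u0 *m J)) -y0_eq0 => /(_ Tt0); lra.
have yt0 : dot y0 t0 = 0 by rewrite {1}y0E; exact: (nearest_cone_orthogonal TZ t0near).
(* Optimality in [u]: [u0] may move both ways along the hyperplane [<g, h> = 0]. *)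
have ker_orth h : dot g h = 0 -> dot y0 (h *m J) = 0.
  move=> gh; apply: (@quadratic_small_eq0 _ _ (dot (h *m J) (h *m J))) => s _.
  have : S (y0 - s *: (h *m J)).
    exists (u0 - s *: h); rewrite dotBr dotZr gh mulr0 subr0; split=> //.
    by rewrite mulmxBl -scalemxAl opprB addrA subrK.
  move=> /ymin; rewrite (dotBl y0) !(dotBr _ (s *: _)) (dotC (s *: _) y0).
  by rewrite !dotZr !dotZl; lra.
have repr h : dot (y0 *m J^T) h = dot y0 y0 * dot g h.
  have /ker_orth : dot g (h - dot g h *: u0) = 0.
    by rewrite dotBr dotZr gu0 mulr1 subrr.
  rewrite mulmxBl -scalemxAl dotBr dotZr -dot_mulmxr => /eqP.
  have -> : u0 *m J = y0 + t0 by rewrite /t0 addrC subrK.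
  by rewrite dotDr yt0 addr0 subr_eq0 => /eqP ->; rewrite mulrC.
exists (u0 *m J), t0, (dot y0 y0)^-1; split=> //; first by rewrite invr_gt0.
rewrite -y0E; apply/eqP; rewrite -subr_eq0; apply/eqP/dot_eq0.
rewrite (dotBl _ g) -scalemxAl dotZl repr.
by rewrite mulKf ?gt_eqF// subrr.
Qed.

End Multiplier.

(** * The stationarity theorem *)

Unset Implicit Arguments.
Set Strict Implicit.

Theorem theorem3 (R : realType) (n m : nat)
    (f : 'rV[R]_n -> R) (F : 'rV[R]_n -> 'rV[R]_m) (D : set 'rV[R]_m)
    (xbar : 'rV[R]_n) (QQ : set (set 'rV[R]_m * set 'rV[R]_m))
    (D_closed : closed D)
    (xbar_feasible : feasible_set F D xbar)
    (F_C1 : continuously_differentiable_at F xbar)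
    (f_C1 : continuously_differentiable_fun_at f xbar)
    (ggcq : GGCQ F D xbar)
    (QQ_admissible : forall Q1 Q2, QQ (Q1, Q2) ->
       admissible_cone F D xbar Q1 /\ admissible_cone F D xbar Q2)
    (xbar_B : B_stationary f F D xbar) :
  [\/ exists Q1 Q2, QQ (Q1, Q2) /\
        pair_multipliers F xbar Q1 Q2 `<=` limiting_normal_cone D (F xbar),
      M_stationary f F D xbar /\
        (forall l, limiting_normal_cone D (F xbar) l ->
           exists Q1 Q2, QQ (Q1, Q2) /\ polar Q1 l)
    | finite_union_of_convex_polyhedral (tangent_cone D (F xbar)) /\
        (forall t, tangent_cone D (F xbar) t ->
           exists Q1 Q2, QQ (Q1, Q2) /\ Q1 t)] ->
  QM_stationary f F D xbar QQ.
Proof.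
set J := 'J F xbar; set g := - gradient f xbar.
have gpolar : polar (linearized_tangent_cone F D xbar) g.
  case: xbar_B => v vN /eqP; rewrite addrC addr_eq0 => /eqP vE.
  by rewrite -ggcq /g -vE.
have multiplier Q : admissible_cone F D xbar Q ->
    exists2 l, polar Q l & l *m J^T = g.
  move=> [_ QT Qpolar].
  have : polar (jac_preimage F xbar Q) g by move=> u Qu; apply: gpolar; exact: QT.
  by rewrite Qpolar => -[l Ql lE]; exists l.
have pairM Q1 Q2 l : QQ (Q1, Q2) -> polar Q1 l -> l *m J^T = g ->
    pair_multipliers F xbar Q1 Q2 l.
  move=> /QQ_admissible[_ /multiplier[l2 Q2l2 l2E]] Q1l lE; split => //.
  exists (l - l2); first by rewrite /jacT_kernel /= mulmxBl lE l2E subrr.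
  by exists l2 => //; rewrite subrK.
have QM Q1 Q2 l : QQ (Q1, Q2) -> polar Q1 l -> l *m J^T = g ->
    limiting_normal_cone D (F xbar) l -> QM_stationary f F D xbar QQ.
  move=> QQ12 Q1l lE lN; exists Q1, Q2; split => //.
  exists g; last by rewrite /g subrr.
  by exists l => //; split => //; exact: pairM.
case=> [[Q1 [Q2 [QQ12 sub]]]|[[v [l lN lE] /eqP]]|[Tpoly cover]].
- have [/multiplier[l1 Q1l1 l1E] _] := QQ_admissible _ _ QQ12.
  by apply: (QM Q1 Q2 l1) => //; apply: sub; exact: pairM.
- rewrite addrC addr_eq0 => /eqP vE cover.
  have [Q1 [Q2 [QQ12 Q1l]]] := cover l lN.
  by apply: (QM Q1 Q2 l) => //; rewrite lE vE.
- have [p [t [c [c0 tnear lE]]]] := @polyhedral_multiplier R n m J _ g Tpoly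
    (@tangent_cone0 _ _ D (F xbar) xbar_feasible)
    (@tangent_coneZ _ _ D (F xbar)) gpolar.
  have [Q1 [Q2 [QQ12 Q1t]]] := cover t (proj1 tnear).
  have [[Q1cone Q1T _] _] := QQ_admissible _ _ QQ12.
  apply: (QM Q1 Q2 (c *: (p - t))) => //.
  + apply: polarZ => // u Q1u; apply: (nearest_regular_normal tnear).
    exact: (tangent_cone_convex_sub Q1cone).
  + by apply: limiting_normal_coneZ => //; exact: limiting_normal_tangent_cone.
Qed.
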